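(* Let $\mu\subseteq\lambda$ be partitions with $\lambda=(\lambda_1,\dots,\lambda_\ell)$ of length $\ell$ and $\mu=(\mu_1,\dots,\mu_\ell)$ (trailing zeros allowed), and let $\mathbf{x}=(x_1,\dots,x_n)$ and $\mathbf{t}=(t_1,t_2,\dots,t_{\lambda_1})$ be commuting indeterminates. Let $\lambda',\mu'$ be the conjugate partitions. Then $$g_{\lambda'/\mu'}(\mathbf{x};\mathbf{t})=\det\left[\sum_{m=0}^{\infty}\widetilde{\alpha}_m^{ij}(\mathbf{t})\,e_{\lambda_i-\mu_j-i+j-m}(\mathbf{x})\right]_{i,j=1}^{\ell},$$ where $$\widetilde{\alpha}_m^{ij}(\mathbf{t})=\begin{cases}e_m(t_{\mu_j+1},\dots,t_{\lambda_i-1})&\text{if }\mu_j\le\lambda_i-1,\\ h_m(-t_{\lambda_i},\dots,-t_{\mu_j})&\text{otherwise.}\end{cases}$$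
   Context: $h_k$ and $e_k$ are the complete homogeneous and elementary symmetric polynomials, with $h_0=e_0=1$, $h_k=e_k=0$ for $k<0$, and $e_m$ of the empty set of variables (the case $\mu_j=\lambda_i-1$) equal to $\delta_{m0}$. A reverse plane partition of skew shape $\kappa/\eta$ (English convention, row 1 at the top) is a filling of the boxes of $\kappa/\eta$ with positive integers that weakly increases along rows and down columns. Let $\mathrm{RPP}^n(\kappa/\eta)$ be the set of those with all entries at most $n$. For such $T$, let $a_i$ be the number of columns of $T$ containing $i$, and let $b_r$ be the number of boxes in row $r$ for which the box directly below lies in $\kappa/\eta$ and has the same entry. The skew refined dual Grothendieck polynomial is $g_{\kappa/\eta}(\mathbf{x};\mathbf{t})=\sum_{T\in\mathrm{RPP}^n(\kappa/\eta)}\prod_r t_r^{b_r}\prod_i x_i^{a_i}$. *)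

(* Defs.v *)
From HB Require Import structures.
From mathcomp Require Import all_boot all_order all_algebra.
From mathcomp Require Export mpoly.

Set Implicit Arguments.
Unset Strict Implicit.
Unset Printing Implicit Defensive.

Import Order.TTheory GRing.Theory Num.Theory.
Local Open Scope ring_scope.

(* A partition is a weakly decreasing sequence of naturals, trailing zeros
   allowed; parts beyond the end of the sequence are 0. *)
Definition is_partition (s : seq nat) : bool := sorted geq s.

Definition conj_part (s : seq nat) : seq nat :=
  mkseq (fun c => count (ltn c) s) (head 0%N s).

Section SkewShapes.

Variables (ka eta : seq nat).

(* Box (r, c), with rows and columns numbered from 0 and row 0 at the top. *)
Definition in_skew (b : 'I_(size ka) * 'I_(head 0%N ka)) : bool :=
  (nth 0 eta b.1 <= b.2 < nth 0 ka b.1)%N.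

Definition box := {b : 'I_(size ka) * 'I_(head 0%N ka) | in_skew b}.

Definition brow (b : box) : 'I_(size ka) := (val b).1.
Definition bcol (b : box) : 'I_(head 0%N ka) := (val b).2.

Variable n : nat.

(* The ordinal i : 'I_n stands for the entry i + 1 in {1, ..., n}. *)
Definition filling := {ffun box -> 'I_n}.

Definition is_rpp (T : filling) : bool :=
  [forall b1 : box, forall b2 : box,
     ((brow b1 == brow b2) && (bcol b1 <= bcol b2)%N
        || (bcol b1 == bcol b2) && (brow b1 <= brow b2)%N)
     ==> (T b1 <= T b2)%N].

Definition rpp_a (T : filling) (i : 'I_n) : nat :=
  #|[set c | [exists b : box, (bcol b == c) && (T b == i)]]|.

Definition rpp_b (T : filling) (r : 'I_(size ka)) : nat :=
  #|[set b : box | (brow b == r) &&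
       [exists b' : box, [&& bcol b' == bcol b,
          nat_of_ord (brow b') == (brow b).+1 & T b' == T b]]]|.

(* t is indexed from 1, so the row with index r carries the weight t_(r+1). *)
Definition dual_groth (A : comNzRingType) (x : 'I_n -> A) (t : nat -> A) : A :=
  \sum_(T : filling | is_rpp T)
    (\prod_(r < size ka) t r.+1 ^+ rpp_b T r) * \prod_(i < n) x i ^+ rpp_a T i.

End SkewShapes.

Section SymmetricFunctions.

Variable A : comNzRingType.

Definition esym (s : seq A) (k : nat) : A :=
  (mesym (size s) A k).@[tnth (in_tuple s)].

(* Weakly increasing index sequences of length k enumerate the monomials of
   degree k. *)
Definition hsym (s : seq A) (k : nat) : A :=
  \sum_(u : k.-tuple 'I_(size s) | sorted leq (map val u))
    \prod_(i <- u) tnth (in_tuple s) i.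

Definition esymz (s : seq A) (k : int) : A :=
  if k is Posz m then esym s m else 0.

(* The list t_(a), t_(a+1), ..., t_(b). *)
Definition trange (t : nat -> A) (a b : nat) : seq A :=
  [seq t k | k <- index_iota a b.+1].

(* lai and muj are the parts lambda_i and mu_j. *)
Definition alpha (t : nat -> A) (lai muj m : nat) : A :=
  if muj%:Z <= lai%:Z - 1 then esym (trange t muj.+1 lai.-1) m
  else hsym [seq - y | y <- trange t lai muj] m.

(* The sum over all m >= 0 of alpha_m e_(d - m): the terms with m > d vanish,
   so the sum may be cut off anywhere above d (see alpha_sum_trunc). *)
Definition alpha_sum (xs : seq A) (t : nat -> A) (lai muj : nat) (d : int) : A :=
  \sum_(0 <= m < `|d|%N.+1) alpha t lai muj m * esymz xs (d - m%:Z).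

Lemma alpha_sum_trunc (xs : seq A) (t : nat -> A) (lai muj : nat) (d : int)
    (N : nat) : (`|d|%N < N)%N ->
  \sum_(0 <= m < N) alpha t lai muj m * esymz xs (d - m%:Z)
    = alpha_sum xs t lai muj d.
Proof.
move=> dN; rewrite /alpha_sum [LHS](big_cat_nat (n := `|d|%N.+1)) //=.
rewrite [X in _ + X = _]big_nat [X in _ + X = _]big1 ?addr0 // => m /andP[dm _].
suff -> : esymz xs (d - m%:Z) = 0 by rewrite mulr0.
have : d - m%:Z < 0.
  by rewrite subr_lt0 (le_lt_trans (lez_abs d)).
by case: (d - m%:Z).
Qed.

End SymmetricFunctions.

(* The polynomial ring in x_1, ..., x_n, t_1, ..., t_p. *)
Definition xvar (R : comNzRingType) (n p : nat) (i : 'I_n) : {mpoly R[n + p]} :=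
  'X_(lshift p i).

(* Indexed from 1; the value outside 1 <= k <= p is a junk value. *)
Definition tvar (R : comNzRingType) (n p : nat) (k : nat) : {mpoly R[n + p]} :=
  nth 0 (0 :: [seq 'X_(rshift n r) | r : 'I_p]) k.

(* Main.v *)
(* The generating function of alpha_m^{ij} in z is the ratio of the products of
   1 + t_k z over k < lambda_i and over k <= mu_j, so, writing E for the product
   of the 1 + x_v z, the (i,j) entry of the determinant is
     [z^(lambda_i - mu_j - i + j)] E * prod_(k < lambda_i) (1 + t_k z)
                                     / prod_(k <= mu_j) (1 + t_k z).
   Let R_i(k) be the i-th row when lambda_i = k. Splitting off one variable y from
   x turns R_i(k) into R_i(k) + y R_(i+1)(k), and R_(i+1)(k+1) = R_i(k) + t_k
   R_(i+1)(k). Unrolling, for every b <= k the new row is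
     sum_(b <= a <= k) w(a,k) R_i(a) + (multiple of R_(i+1)(b)),
   where w(k,k) = 1 and w(a,k) = y t_(a+1) ... t_(k-1) for a < k. Expanding the
   rows from the bottom up, with b the part chosen in the row below, the last term
   is always killed by that row, so the determinant for (x, y) is the sum over
   partitions nu inside lambda of prod_i w(nu_i, lambda_i) times the determinant
   of nu for x. Without variables x the determinant is 1 if lambda = mu and has a
   large zero block otherwise. The determinant is thus a weighted sum over chains
   of partitions from mu to lambda, and these are the level sets of the reverse
   plane partitions of shape lambda'/mu', with the same weights. *)
Require Import Defs.
From mathcomp Require Import all_boot all_order perm all_algebra.
From mathcomp Require Import zify ring.
Set Implicit Arguments.
Unset Strict Implicit.
Unset Printing Implicit Defensive.

Import Order.TTheory GRing.Theory Num.Theory.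
Local Open Scope ring_scope.

Local Notation esym := Defs.esym.

(** * Recurrences for elementary and complete homogeneous polynomials *)

Lemma meval_mwiden (A : comNzRingType) n (p : {mpoly A[n]}) (v : 'I_n.+1 -> A) :
  (mwiden p).@[v] = p.@[v \o widen_ord (leqnSn n)].
Proof.
rewrite (mpolyE p) (raddf_sum (@mwiden n A)) /= !raddf_sum /=.
apply: eq_bigr => m _.
rewrite mwidenZ !mevalZ mwidenX !mevalX big_ord_recr /= mnmwiden_ordmax expr0 mulr1.
by congr (_ * _); apply: eq_bigr => i _; rewrite mnmwiden_widen.
Qed.

Section SymmetricFunctionRecurrences.
Variable A : comNzRingType.
Implicit Types (s : seq A) (y : A) (k : nat).

Lemma esymE s n k : size s = n -> esym s k = (mesym n A k).@[fun i => s`_i].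
Proof.
by move=> <-; apply: meval_eq => i; rewrite (tnth_nth 0).
Qed.

Lemma esym0 s : esym s 0 = 1.
Proof. by rewrite /esym mesym0E meval1. Qed.

Lemma esym_gt_size s k : (size s < k)%N -> esym s k = 0.
Proof. by move=> sk; rewrite /esym mesym_geqnE // meval0. Qed.

Lemma esym_rcons s y k : esym (rcons s y) k.+1 = esym s k.+1 + y * esym s k.
Proof.
rewrite (esymE _ (size_rcons s y)) mesymSS mevalD mevalM mevalXU /=.
rewrite nth_rcons ltnn eqxx mulrC !meval_mwiden.
have E j : (mesym (size s) A j).@[(fun i => (rcons s y)`_i)
    \o widen_ord (leqnSn (size s))] = esym s j.
  rewrite (esymE _ (erefl (size s))); apply: meval_eq => i /=.
  by rewrite nth_rcons ltn_ord.
by rewrite !E.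
Qed.

Lemma hsymE s n k : size s = n ->
  hsym s k = \sum_(u : k.-tuple 'I_n | sorted leq (map val u)) \prod_(i <- u) s`_i.
Proof.
move=> <-; apply: eq_bigr => u _; apply: eq_bigr => i _.
by rewrite (tnth_nth 0).
Qed.

Lemma hsym0 s : hsym s 0 = 1.
Proof.
rewrite /hsym (big_pred1 [tuple]) => [|u]; first by rewrite big_nil.
by rewrite tuple0 /= eqxx.
Qed.

Lemma hsym_nil k : hsym ([::] : seq A) k.+1 = 0.
Proof. by rewrite /hsym big1 // => u _; case: (thead u). Qed.

(** Index sequences are split by their first index. Removing a leading 0 gives the second term; a
    sorted sequence not starting with 0 avoids 0, and shifting its indices down gives the first
    term. *)
Lemma hsym_cons s y k : hsym (y :: s) k.+1 = hsym s k.+1 + y * hsym (y :: s) k.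
Proof.
pose n := size s.
rewrite (@hsymE _ n.+1) // (bigID (fun u : k.+1.-tuple 'I_n.+1 => thead u == ord0)) /=.
rewrite addrC; congr (_ + _); last first.
  rewrite (@hsymE _ n.+1) // big_distrr /=.
  rewrite (reindex_onto (fun u : k.-tuple 'I_n.+1 => [tuple of ord0 :: u])
                        (fun u => [tuple of behead u])) /=; last first.
    move=> u /andP[_ /eqP u0]; rewrite [u in RHS]tuple_eta u0.
    by apply: val_inj.
  apply: eq_big => [u|u _]; last by rewrite big_cons.
  rewrite theadE eqxx andbT.
  have -> : [tuple of behead (ord0 :: u)] == u by apply/eqP/val_inj.
  rewrite andbT; case: (val u) => //= a r.
rewrite (@hsymE _ n) //.
(* The map [g] below needs a default index, so empty [s] is treated apart; both sums are then 0. *)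
case En : n => [|m].
  rewrite [RHS]big1 => [|u _]; last by case: (thead u).
  rewrite big1 // => u /andP[_]; case: (thead u) => [] [|j] // ij /=.
pose f (u : k.+1.-tuple 'I_m.+1) : k.+1.-tuple 'I_m.+2 :=
  [tuple of map (lift ord0) u].
pose g (u : k.+1.-tuple 'I_m.+2) : k.+1.-tuple 'I_m.+1 :=
  [tuple of map (fun i => odflt ord0 (unlift ord0 i)) u].
rewrite (reindex_onto f g) /=; last first.
  move=> u /andP[us u0]; apply: val_inj; rewrite /= -map_comp -[RHS]map_id.
  apply/eq_in_map => i iu /=.
  (* The indices increase weakly from a nonzero one, so [g] never falls back on its default. *)
  have i0 : i != ord0.
    move: us u0 iu; rewrite (tuple_eta u) theadE /=; move: (thead u) => a.
    rewrite path_sortedE; last exact: leq_trans.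
    move=> /andP[/allP ua _] a0; rewrite inE => /orP[/eqP->//|iu].
    have := ua _ (map_f val iu); apply: contraL => /eqP ->.
    by rewrite leqn0; apply: contra a0 => /eqP a0; apply/eqP/val_inj.
  by case: unliftP i0 => [j ->|->].
apply: eq_big => [u|u _]; last by rewrite big_map.
have -> : g (f u) = u.
  apply: val_inj; rewrite /= -map_comp -[RHS]map_id; apply: eq_map => i /=.
  by rewrite liftK.
rewrite eqxx andbT; case/tupleP: u => a u; rewrite /thead tnth_map /= andbT.
have -> : map val (map (lift ord0) u) = map S (map val u).
  by rewrite -!map_comp; apply: eq_map.
by rewrite [bump 0 a]add1n path_map.
Qed.

End SymmetricFunctionRecurrences.

(** * Recurrences for the entries of the determinant *)

Section AlphaSums.
Variables (A : comNzRingType) (t : nat -> A).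
Implicit Types (xs : seq A) (a b m : nat) (d : int).

Lemma alphaE a b m :
  alpha t a b m = if (b < a)%N then esym (trange t b.+1 a.-1) m
                  else hsym [seq - y | y <- trange t a b] m.
Proof. by rewrite /alpha; congr (if _ then _ else _); lia. Qed.

Lemma trange_nil a b : (b < a)%N -> trange t a b = [::].
Proof. by move=> ba; rewrite /trange /index_iota (_ : b.+1 - a = 0)%N //; lia. Qed.

Lemma trange_cons a b : (a <= b)%N -> trange t a b = t a :: trange t a.+1 b.
Proof.
by move=> ab; rewrite /trange /index_iota (_ : b.+1 - a = (b.+1 - a.+1).+1)%N //; lia.
Qed.

Lemma trange_rcons a b : (a <= b.+1)%N ->
  trange t a b.+1 = rcons (trange t a b) (t b.+1).
Proof.
move=> ab; rewrite /trange /index_iota (_ : b.+2 - a = b.+1 - a + 1)%N; last by lia.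
by rewrite iotaD map_cat /= cats1 subnKC.
Qed.

Lemma alpha0 a b : alpha t a b 0 = 1.
Proof. by rewrite alphaE; case: ifP => _; rewrite ?esym0 ?hsym0. Qed.

(* The generating function of alpha is the ratio of the products of 1 + t_k z
   over k < a and over k <= b. *)
Lemma alphaS a b m :
  alpha t a.+1 b m.+1 = alpha t a b m.+1 + t a * alpha t a b m.
Proof.
(* For [b < a] the list in [esym] gains [t a]; for [a < b] the list in [hsym] loses [- t a]. At
   [a = b] the two cases meet: [hsym] of the single variable [- t a] turns into [esym] of the empty
   list. *)
rewrite !alphaE; case: (ltngtP b a) => [ba|ab|->] /=.
- rewrite ltnS ltnW //; case: a ba => // a ba.
  by rewrite /= trange_rcons ?esym_rcons.
- rewrite ltnNge ab /= [in RHS]trange_cons; last exact: ltnW.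
  by rewrite /= hsym_cons mulNr addrNK.
- rewrite ltnSn trange_nil // esym_gt_size // trange_cons // trange_nil //=.
  by rewrite hsym_cons hsym_nil add0r mulNr addNr.
Qed.

Lemma esymz_lt0 xs d : d < 0 -> esymz xs d = 0.
Proof. by case: d. Qed.

Lemma esymz_rcons xs y d :
  esymz (rcons xs y) d = esymz xs d + y * esymz xs (d - 1).
Proof.
case: d => [[|d]|d]; first by rewrite /= !esym0 mulr0 addr0.
- have -> : d.+1%:Z - 1 = d%:Z by lia.
  exact: esym_rcons.
- by rewrite esymz_lt0 ?mulr0 ?addr0 //; lia.
Qed.

Lemma alpha_sum_lt0 xs a b d : d < 0 -> alpha_sum xs t a b d = 0.
Proof.
by move=> d0; rewrite /alpha_sum big1 // => m _; rewrite esymz_lt0 ?mulr0 //; lia.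
Qed.

Lemma alpha_sum0 xs a b : alpha_sum xs t a b 0 = 1.
Proof. by rewrite /alpha_sum big_nat1 alpha0 /= esym0 mulr1. Qed.

Lemma alpha_sum_rcons xs y a b d :
  alpha_sum (rcons xs y) t a b d
  = alpha_sum xs t a b d + y * alpha_sum xs t a b (d - 1).
Proof.
(* A cutoff valid for both degrees [d] and [d - 1]. *)
pose N := (`|d|%N + 2)%N.
rewrite -!(@alpha_sum_trunc _ _ _ _ _ _ N); [|lia..].
rewrite big_distrr -big_split /=; apply: eq_bigr => m _.
by rewrite esymz_rcons addrAC; ring.
Qed.

Lemma alpha_sumS xs a b d :
  alpha_sum xs t a.+1 b d
  = alpha_sum xs t a b d + t a * alpha_sum xs t a b (d - 1).
Proof.
pose N := (`|d|%N + 2)%N.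
(* The sums of degree [d] get one more term, since the sum of degree [d - 1] is matched with their
   terms from [m = 1] on. *)
rewrite -!(@alpha_sum_trunc _ _ _ _ _ d N.+1); [|lia..].
rewrite -(@alpha_sum_trunc _ _ _ _ _ (d - 1) N); last by lia.
rewrite !big_nat_recl // !alpha0 big_distrr -addrA -big_split /=; congr (_ + _).
apply: eq_bigr => m _; rewrite alphaS.
by rewrite (_ : d - 1 - m%:Z = d - m.+1%:Z); [ring | lia].
Qed.

(** Without variables x only the term [m = d] survives, and it is an elementary polynomial of degree
    [d] in [a - b - 1] variables. *)
Lemma alpha_sum_nil a b d : (b < a)%N -> a%:Z - b%:Z <= d ->
  alpha_sum [::] t a b d = 0.
Proof.
move=> ba abd; rewrite /alpha_sum big_nat_recr //= big_nat big1 => [|m md].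
  rewrite add0r alphaE ba esym_gt_size ?mul0r //.
  by rewrite size_map size_iota; lia.
rewrite (_ : esymz _ _ = 0) ?mulr0 //.
have : 0 < d - m%:Z by lia.
by case: (d - m%:Z) => // -[|k] // _; rewrite /= esym_gt_size.
Qed.

End AlphaSums.

(** * Removing one variable from the determinant *)

Section JacobiTrudiMatrix.
Variables (A : comNzRingType) (t : nat -> A) (l N : nat).
Implicit Types (xs : seq A) (y : A) (mu nu la : {ffun 'I_l -> 'I_N}).

Definition antitone nu :=
  [forall i : 'I_l, forall j : 'I_l, (i <= j)%N ==> (nu j <= nu i)%N].

(* Row and column indices start at 0; the row index i is a natural number because
   the expansion of the last row involves the row below it. *)
Definition jt_entry xs (i k m j : nat) : A :=
  alpha_sum xs t k m (k%:Z - m%:Z - i%:Z + j%:Z).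

Definition jt_mx xs nu mu : 'M[A]_l :=
  \matrix_(i, j) jt_entry xs i (nu i) (mu j) j.

(** The weight of a column growing from height [a] to [b] by boxes with one common entry: [y] if it
    grows at all, and a factor [t] for each new box but the lowest. *)
Definition step_weight y (a b : nat) : A :=
  (if (a < b)%N then y else 1) * \prod_(a.+1 <= s < b) t s.

Lemma antitoneP nu :
  reflect (forall i j : 'I_l, (i <= j)%N -> (nu j <= nu i)%N) (antitone nu).
Proof.
apply: (iffP forallP) => [nuP i j ij|nuP i].
  exact: (implyP (forallP (nuP i) j)).
by apply/forallP => j; apply/implyP => /nuP.
Qed.

Lemma jt_entry_rcons xs y i k m j :
  jt_entry (rcons xs y) i k m j = jt_entry xs i k m j + y * jt_entry xs i.+1 k m j.
Proof.
rewrite /jt_entry alpha_sum_rcons; congr (_ + _ * alpha_sum _ _ _ _ _); lia.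
Qed.

Lemma jt_entrySS xs i k m j :
  jt_entry xs i.+1 k.+1 m j = jt_entry xs i k m j + t k * jt_entry xs i.+1 k m j.
Proof.
rewrite /jt_entry alpha_sumS.
by congr (alpha_sum _ _ _ _ _ + _ * alpha_sum _ _ _ _ _); lia.
Qed.

Lemma jt_entryS_expand xs i b k m j : (b <= k)%N ->
  jt_entry xs i.+1 k m j
  = \sum_(b <= a < k) (\prod_(a.+1 <= s < k) t s) * jt_entry xs i a m j
    + (\prod_(b <= s < k) t s) * jt_entry xs i.+1 b m j.
Proof.
elim: k => [|k IHk]; first by rewrite leqn0 => /eqP ->; rewrite !big_geq // mul1r add0r.
rewrite leq_eqVlt => /orP[/eqP <-|bk].
  by rewrite !big_geq // mul1r add0r.
rewrite jt_entrySS IHk // [in RHS]big_nat_recr //= (big_geq (leqnn _)) mul1r.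
rewrite [\prod_(b <= s < k.+1) _]big_nat_recr //=.
rewrite (_ : \sum_(b <= a < k) (\prod_(a.+1 <= s < k.+1) t s) * jt_entry xs i a m j
  = t k * \sum_(b <= a < k) (\prod_(a.+1 <= s < k) t s) * jt_entry xs i a m j).
  by ring.
rewrite big_distrr; apply: eq_big_nat => a /andP[_ ak].
by rewrite big_nat_recr //=; ring.
Qed.

Lemma jt_entry_rcons_expand xs y i b k m j : (b <= k)%N ->
  jt_entry (rcons xs y) i k m j
  = \sum_(b <= a < k.+1) step_weight y a k * jt_entry xs i a m j
    + (y * \prod_(b <= s < k) t s) * jt_entry xs i.+1 b m j.
Proof.
move=> bk; rewrite jt_entry_rcons (jt_entryS_expand _ _ _ _ bk) big_nat_recr //=.
rewrite {2}/step_weight ltnn (big_geq (leqnSn _)) !mul1r mulrDr mulrA addrCA addrA.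
congr (_ + _ + _); rewrite big_distrr; apply: eq_big_nat => a /andP[_ ak].
by rewrite /= /step_weight ak mulrA.
Qed.

(** Matrices that differ only in row [i0] share the cofactors along it. The term in [C] is kept
    apart because it will vanish. *)
Lemma det_row_sum (I : finType) (P : pred I) (i0 : 'I_l) (M C : 'M[A]_l)
    (B : I -> 'M[A]_l) (w : I -> A) (c : A) :
    (forall j, M i0 j = \sum_(k | P k) w k * B k i0 j + c * C i0 j) ->
    (forall k i j, i != i0 -> B k i j = M i j) ->
    (forall i j, i != i0 -> C i j = M i j) ->
  \det M = \sum_(k | P k) w k * \det (B k) + c * \det C.
Proof.
move=> M0 BM CM.
have cofE (D : 'M[A]_l) : (forall i j, i != i0 -> D i j = M i j) ->
    \det D = \sum_j D i0 j * cofactor M i0 j.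
  move=> DM; rewrite (expand_det_row _ i0); apply: eq_bigr => j _.
  congr (_ * (_ * \det _)); apply/matrixP => i k; rewrite !mxE DM //.
  by rewrite eq_sym neq_lift.
rewrite (cofE M) // (cofE C) // big_distrr /=.
under [X in _ = X + _]eq_bigr => k _ do rewrite (cofE (B k) (BM k)) big_distrr /=.
rewrite exchange_big -big_split /=; apply: eq_bigr => j _.
rewrite M0 mulrDl big_distrl mulrA /=; congr (_ + _).
by apply: eq_bigr => k _; rewrite mulrA.
Qed.

Section Step.
Variables (xs : seq A) (y : A) (la mu : {ffun 'I_l -> 'I_N}).
Hypothesis la_anti : antitone la.

(** The state of the expansion once the rows from [s] on are done: these carry the chosen parts of
    [nu] and no [y], while the rows before [s] still carry [y] and the parts of [la]. [mixed_sum]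
    interpolates between the two sides of [det_jt_mx_rcons]. *)
Let P (s : nat) nu := [&& antitone nu, [forall i, (nu i <= la i)%N]
  & [forall i : 'I_l, (i < s)%N ==> (nu i == la i)]].

Let mixed_mx (s : nat) nu : 'M[A]_l := \matrix_(i, j)
  if (i < s)%N then jt_entry (rcons xs y) i (la i) (mu j) j
  else jt_entry xs i (nu i) (mu j) j.

Let mixed_sum s :=
  \sum_(nu | P s nu) (\prod_i step_weight y (nu i) (la i)) * \det (mixed_mx s nu).

Let upd nu (s : 'I_l) (k : 'I_N) : {ffun 'I_l -> 'I_N} :=
  [ffun i => if i == s then k else nu i].

(* The part below row s, which is 0 for the last row. *)
Let floor nu (s : 'I_l) : nat :=
  odflt 0%N (omap (fun i => nat_of_ord (nu i)) (insub s.+1)).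

Let PP s nu : reflect
  [/\ antitone nu, forall i, (nu i <= la i)%N & forall i : 'I_l, (i < s)%N -> nu i = la i]
  (P s nu).
Proof.
apply: (iffP and3P) => [] [-> nula nus]; split => //; try exact/forallP.
  by move=> i si; apply/eqP; apply: (implyP (forallP nus i)).
by apply/forallP => i; apply/implyP => /nus ->.
Qed.

(** The rows before [s] have parts at least [la s], so only the row below restricts the new part any
    further. *)
Let P_upd (s : 'I_l) nu k : P s.+1 nu ->
  P s (upd nu s k) = (floor nu s <= k <= la s)%N.
Proof.
move=> /PP[/antitoneP nu_anti nula nus].
apply/PP/andP => [[/antitoneP ua ul us]|[fk ks]]; split.
- rewrite /floor; case: insubP => //= i _ ei; have {}ei : nat_of_ord i = s.+1 := ei.
  have ins : i != s by rewrite -val_eqE /= ei; lia.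
  by have := ua s i; rewrite !ffunE eqxx (negPf ins) ei; apply.
- by have := ul s; rewrite ffunE eqxx.
- apply/antitoneP => i j ij; rewrite !ffunE.
  case: (eqVneq j s) => [ej|js]; case: (eqVneq i s) => [ei|ins] //.
    rewrite nus; last by move: ij ins; rewrite ej -val_eqE /=; lia.
    rewrite (leq_trans ks) //; apply: (antitoneP _ la_anti); by rewrite -ej.
  apply: leq_trans fk; have sj : (s.+1 <= j)%N.
    by move: ij js; rewrite ei -val_eqE /=; lia.
  have sl : (s.+1 < l)%N by apply: leq_ltn_trans (ltn_ord j).
  by rewrite /floor insubT /=; apply: nu_anti.
  exact: nu_anti.
- by move=> i; rewrite ffunE; case: eqP => [->|].
- move=> i si; have ins : i != s by rewrite -val_eqE /=; lia.
  by rewrite ffunE (negPf ins) nus //; lia.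
Qed.

Let mixed_det (s : 'I_l) nu : P s.+1 nu ->
  \det (mixed_mx s.+1 nu)
  = \sum_(k : 'I_N | (floor nu s <= k <= la s)%N)
      step_weight y k (la s) * \det (mixed_mx s (upd nu s k)).
Proof.
move=> /PP[/antitoneP nu_anti nula nus].
pose b := floor nu s.
have bla : (b <= la s)%N.
  rewrite /b /floor; case: insubP => //= i _ ei; have {}ei : nat_of_ord i = s.+1 := ei.
  apply: leq_trans (nula i) _; apply: (antitoneP _ la_anti); by rewrite ei.
pose C : 'M[A]_l := \matrix_(i, j)
  if i == s then jt_entry xs s.+1 b (mu j) j else mixed_mx s.+1 nu i j.
rewrite (@det_row_sum _ (fun k : 'I_N => (b <= k <= la s)%N) s _ C
  (fun k => mixed_mx s (upd nu s k)) (fun k => step_weight y k (la s))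
  (y * \prod_(b <= r < la s) t r)).
- suff -> : \det C = 0 by rewrite mulr0 addr0.
  rewrite /C /b /floor; case: insubP => [i _ ei|] /=.
    (* Row [s] of [C] repeats the row below it, whose part is [b]. *)
    have {}ei : nat_of_ord i = s.+1 := ei.
    have ins : i != s by rewrite -val_eqE /= ei; lia.
    apply: (@determinant_alternate _ _ _ s i); first by rewrite eq_sym.
    by move=> j; rewrite !mxE eqxx (negPf ins) ei ltnn.
  (* For the last row [b] is 0 and [s.+1] is [l], so row [s] of [C] has entries of negative
     degree. *)
  rewrite -leqNgt => ls; rewrite (expand_det_row _ s) big1 // => j _.
  rewrite mxE eqxx /jt_entry alpha_sum_lt0 ?mul0r //.
  by have := ltn_ord j; lia.
- move=> j; rewrite !mxE ltnSn eqxx (jt_entry_rcons_expand _ _ _ _ _ bla).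
  congr (_ + _).
  rewrite (big_nat_widen _ _ N) ?ltn_ord // (big_nat_widenl _ 0) // big_mkord.
  apply: eq_big => [k|k _]; first by rewrite ltnS andbC.
  by rewrite mxE ltnn ffunE eqxx.
- move=> k i j ins; rewrite !mxE ffunE (negPf ins) ltnS [(i <= s)%N]leq_eqVlt.
  by rewrite [nat_of_ord i == s](negPf ins).
- by move=> i j ins; rewrite mxE (negPf ins).
Qed.

(** The terms on the right are grouped by what [nu] becomes when its part in row [s] is reset to
    [la s]; each group is one expansion [mixed_det]. *)
Let mixed_sumS (s : 'I_l) : mixed_sum s.+1 = mixed_sum s.
Proof.
rewrite /mixed_sum.
rewrite [RHS](partition_big (fun nu => upd nu s (la s)) (P s.+1)) /=; last first.
  move=> nu /PP[/antitoneP nu_anti nula nus].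
  apply/PP; split.
  - apply/antitoneP => i j ij; rewrite !ffunE.
    case: (eqVneq j s) => [ej|js]; case: (eqVneq i s) => [ei|ins] //.
    + rewrite nus; last by move: ij ins; rewrite ej -val_eqE /=; lia.
      by apply: (antitoneP _ la_anti); rewrite -ej.
    + by apply: leq_trans (nula j) _; apply: (antitoneP _ la_anti); rewrite -ei.
    + exact: nu_anti.
  - by move=> i; rewrite ffunE; case: eqP => [->|].
  - move=> i; rewrite ltnS ffunE; case: (eqVneq i s) => [->|ins] // si.
    by apply: nus; rewrite ltn_neqAle si andbT.
apply: eq_bigr => nu Pnu; rewrite mixed_det // big_distrr /=.
have /PP[_ _ nus] := Pnu.
rewrite [RHS](reindex_onto (upd nu s) (fun nu' => nu' s)) /=; last first.
  move=> nu' /andP[_ /eqP <-]; apply/ffunP => i; rewrite !ffunE.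
  by case: eqP => [->|].
apply: eq_big => [k|k _].
  rewrite P_upd // ffunE !eqxx andbT.
  have -> : upd (upd nu s k) s (la s) = nu; last by rewrite eqxx andbT.
  apply/ffunP => i; rewrite !ffunE; case: eqP => [->|//].
  by rewrite nus.
rewrite mulrA; congr (_ * _); rewrite (bigD1 s) //= [RHS](bigD1 s) //= ffunE eqxx.
(* On the left, row [s] still has the part [la s] and contributes the factor 1. *)
rewrite nus // {1}/step_weight ltnn (big_geq (leqnSn _)) !mul1r mulrC.
by congr (_ * _); apply: eq_bigr => i ins; rewrite ffunE (negPf ins).
Qed.

(** At [s = l] the only term of [mixed_sum] is [la], with weight 1; at [s = 0] all rows are
    expanded. *)
Lemma det_jt_mx_rcons :
  \det (jt_mx (rcons xs y) la mu)
  = \sum_(nu | antitone nu && [forall i, (nu i <= la i)%N])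
      (\prod_i step_weight y (nu i) (la i)) * \det (jt_mx xs nu mu).
Proof.
have sumE s : (s <= l)%N -> mixed_sum s = mixed_sum 0.
  elim: s => // s IHs sl; rewrite -IHs; last exact: ltnW.
  exact: (mixed_sumS (Ordinal sl)).
transitivity (mixed_sum l).
  rewrite /mixed_sum (big_pred1 la) => [|nu].
    rewrite big1 ?mul1r => [|i _]; last first.
      by rewrite /step_weight ltnn (big_geq (leqnSn _)) mul1r.
    by congr (\det _); apply/matrixP => i j; rewrite !mxE ltn_ord.
  apply/PP/eqP => [[_ _ nul]|->]; first by apply/ffunP => i; apply: nul.
  by split.
rewrite sumE //; apply: eq_big => [nu|nu _].
  rewrite /P [X in [&& _, _ & X]](_ : _ = true) ?andbT //.
  by apply/forallP.
by congr (_ * \det _); apply/matrixP => i j; rewrite !mxE.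
Qed.

End Step.

End JacobiTrudiMatrix.

(** * Determinants without variables x, and sums over chains *)

Lemma det_zero_block (A : comNzRingType) l (M : 'M[A]_l) (r : 'I_l) :
  (forall i j : 'I_l, (r <= i)%N -> (j <= r)%N -> M i j = 0) -> \det M = 0.
Proof.
move=> M0; rewrite /determinant big1 // => s _.
(* The [l - r] rows from [r] on do not fit into the [l - r - 1] columns after [r], so every
   permutation meets the zero block. *)
suff [i ri sr] : exists2 i : 'I_l, (r <= i)%N & (s i <= r)%N.
  by rewrite (bigD1 i) //= M0 // mul0r mulr0.
pose U := [set i : 'I_l | (r <= i)%N]; pose V := [set i : 'I_l | (r < i)%N].
have VU : V \proper U.
  apply/properP; split; first by apply/subsetP => i; rewrite !inE; apply: ltnW.
  by exists r; rewrite inE ?leqnn ?ltnn.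
have : ~~ (s @: U \subset V).
  apply: contraTN (proper_card VU) => /subset_leq_card.
  by rewrite card_imset -?leqNgt //; apply: perm_inj.
case/subsetPn => _ /imsetP[i iU ->]; rewrite !inE in iU * => si.
by exists i; rewrite // leqNgt.
Qed.

Section Chains.
Variables (A : comNzRingType) (t : nat -> A) (l N : nat).
Implicit Types (xs : seq A) (y : A) (mu nu la : {ffun 'I_l -> 'I_N}).

Lemma det_jt_mx_eq0 xs nu mu (r : 'I_l) : antitone nu -> antitone mu ->
  (nu r < mu r)%N -> \det (jt_mx t xs nu mu) = 0.
Proof.
move=> /antitoneP nuP /antitoneP muP r_lt; apply: (@det_zero_block _ _ _ r) => i j ri jr.
rewrite mxE /jt_entry alpha_sum_lt0 //.
by have := nuP _ _ ri; have := muP _ _ jr; lia.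
Qed.

(** For equal partitions the matrix is triangular with diagonal 1. Otherwise let them differ at [r]:
    if [nu r] is smaller, a block has negative degrees; if it is larger, the opposite block vanishes
    by [alpha_sum_nil]. *)
Lemma det_jt_mx_nil nu mu : antitone nu -> antitone mu ->
  \det (jt_mx t [::] nu mu) = (nu == mu)%:R.
Proof.
move=> nu_anti mu_anti; have [nuP muP] := (antitoneP _ nu_anti, antitoneP _ mu_anti).
case: eqVneq => [->|neq].
  rewrite -det_tr det_trig.
    rewrite big1 // => i _; rewrite !mxE /jt_entry.
    by rewrite (_ : _ + _ = 0) ?alpha_sum0 //; lia.
  apply/is_trig_mxP => i j ij; rewrite !mxE /jt_entry alpha_sum_lt0 //.
  by have := muP i j (ltnW ij); lia.
have [r /eqP nr] : exists r, nu r != mu r.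
  apply/existsP; apply: contraNT neq => /existsPn nm; apply/eqP/ffunP => r.
  by apply/eqP; have := nm r; rewrite negbK.
have : nat_of_ord (nu r) <> mu r by move=> e; apply: nr; apply: val_inj.
case: (ltngtP (nu r) (mu r)) => // rlt _; first exact: det_jt_mx_eq0 rlt.
rewrite -det_tr; apply: (@det_zero_block _ _ _ r) => j i rj ir.
rewrite !mxE /jt_entry alpha_sum_nil //.
  by have := nuP _ _ ir; have := muP _ _ rj; lia.
by have := nuP _ _ ir; have := muP _ _ rj; lia.
Qed.

Definition part_le nu la := [forall i, (nu i <= la i)%N].

Definition is_chain n mu la (h : {ffun 'I_n.+1 -> {ffun 'I_l -> 'I_N}}) :=
  [&& h ord0 == mu, h ord_max == la
    & [forall v : 'I_n,
         antitone (h (inord v)) && part_le (h (inord v)) (h (inord v.+1))]].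

Definition chain_weight n (x : 'I_n -> A) (h : {ffun 'I_n.+1 -> {ffun 'I_l -> 'I_N}}) :=
  \prod_(v < n) \prod_i step_weight t (x v) (h (inord v) i) (h (inord v.+1) i).

Lemma is_chain_rcons n mu la (h : {ffun 'I_n.+1 -> {ffun 'I_l -> 'I_N}}) :
  is_chain mu la [ffun v : 'I_n.+2 => if (v < n.+1)%N then h (inord v) else la]
  = [&& is_chain mu (h ord_max) h, antitone (h ord_max) & part_le (h ord_max) la].
Proof.
rewrite /is_chain !ffunE /= ltnn !eqxx /=.
rewrite (_ : inord 0 = ord0); last by apply: val_inj; rewrite /= inordK.
rewrite -andbA; congr (_ && _).
have ffE (v : 'I_n.+1) : [ffun v0 : 'I_n.+2 => if (v0 < n.+1)%N then h (inord v0) else la]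
    (inord v) = h (inord v).
  by rewrite ffunE inordK ?ltn_ord // ltnS ltnW.
apply/forallP/and3P => [hP|[/forallP hP anti le] v].
  split; first apply/forallP => v.
  - have := hP (widen_ord (leqnSn n) v).
    by rewrite ffE ffunE inordK /= ?ltnS ?ltn_ord // ltnW // ltnS.
  - by have := hP ord_max; rewrite ffE /= (_ : inord n = ord_max) => [/andP[]|];
      last by apply: val_inj; rewrite /= inordK.
  have := hP ord_max; rewrite ffE ffunE /= inordK // ltnn.
  rewrite (_ : inord n = ord_max) => [/andP[]//|].
  by apply: val_inj; rewrite /= inordK.
rewrite ffE ffunE inordK; last exact: (ltn_ord v).
rewrite ltnS; case: (ltnP v n) => [vn|nv].
  by have := hP (Ordinal vn).
have -> : inord v = ord_max :> 'I_n.+1.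
  by apply: val_inj; rewrite /= inordK //; have := ltn_ord v; lia.
by rewrite anti le.
Qed.

(** Chains are grouped by their last member [nu] before [la]; [ext] appends [la]. *)
Lemma sum_chainS n (x : 'I_n.+1 -> A) mu la :
  \sum_(h | is_chain mu la h) chain_weight x h
  = \sum_(nu | antitone nu && part_le nu la)
      (\prod_i step_weight t (x ord_max) (nu i) (la i)) *
      \sum_(h | is_chain mu nu h) chain_weight (fun v => x (widen_ord (leqnSn n) v)) h.
Proof.
pose ext (h : {ffun 'I_n.+1 -> {ffun 'I_l -> 'I_N}}) :
    {ffun 'I_n.+2 -> {ffun 'I_l -> 'I_N}} :=
  [ffun v : 'I_n.+2 => if (v < n.+1)%N then h (inord v) else la].
rewrite (reindex_onto ext (fun h => [ffun v : 'I_n.+1 => h (inord v)])) /=; last first.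
  move=> h /and3P[_ /eqP hmax _]; apply/ffunP => v; rewrite !ffunE.
  case: ltnP => [vn|nv]; first by rewrite inordK // inord_val.
  by rewrite -hmax; congr (h _); apply: val_inj => /=; have := ltn_ord v; lia.
rewrite (partition_big (fun h : {ffun 'I_n.+1 -> {ffun 'I_l -> 'I_N}} => h ord_max)
  (fun nu => antitone nu && part_le nu la)) /=.
  apply: eq_bigr => nu /andP[nu_anti nula]; rewrite big_distrr /=.
  apply: eq_big => [h|h /andP[_ /eqP hmax]].
    have -> : [ffun v : 'I_n.+1 => ext h (inord v)] = h.
      apply/ffunP => v; rewrite !ffunE inordK ?ltn_ord ?inord_val //.
      by rewrite ltnS ltnW.
    rewrite eqxx andbT is_chain_rcons; case: (eqVneq (h ord_max) nu) => [->|hn].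
      by rewrite nu_anti nula !andbT.
    by rewrite andbF /is_chain (negPf hn) andbF.
  rewrite /chain_weight big_ord_recr /= mulrC; congr (_ * _).
    apply: eq_bigr => i _; rewrite !ffunE !inordK // ltnS leqnn ltnn -hmax.
    by congr (step_weight _ _ (h _ _) _); apply: val_inj; rewrite /= inordK.
  apply: eq_bigr => v _; apply: eq_bigr => i _; rewrite !ffunE.
  have vn := ltn_ord v.
  by rewrite !inordK ?(ltnS, ltnW vn, vn) //; lia.
by move=> h /andP[]; rewrite is_chain_rcons => /and3P[_ -> ->].
Qed.

(** By induction on the number of variables: the last variable accounts for the last step of the
    chain. *)
Lemma det_jt_mx_chains n (x : 'I_n -> A) mu la : antitone mu -> antitone la ->
  \det (jt_mx t (codom x) la mu) = \sum_(h | is_chain mu la h) chain_weight x h.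
Proof.
move=> mu_anti; elim: n x la => [|n IHn] x la la_anti.
  rewrite (_ : codom x = [::]); last by apply: size0nil; rewrite size_codom card_ord.
  rewrite det_jt_mx_nil //.
  case: eqVneq => [->|neq]; last first.
    rewrite big1 // => h /and3P[/eqP h0 /eqP h1 _]; case/negP: neq.
    by rewrite -h0 -h1; apply/eqP; congr (h _); apply: val_inj.
  rewrite (big_pred1 [ffun=> mu]) => [|h]; first by rewrite /chain_weight big_ord0.
  apply/and3P/eqP => [[/eqP h0 _ _]|->].
    by apply/ffunP => v; rewrite ffunE -h0; congr (h _); apply: val_inj; case: v => [[]].
  by split; rewrite ?ffunE //; apply/forallP => [[]].
have -> : codom x = rcons (codom (fun v => x (widen_ord (leqnSn n) v))) (x ord_max).
  by rewrite !codomE enum_ordSr map_rcons -map_comp.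
rewrite det_jt_mx_rcons // sum_chainS; apply: eq_bigr => nu /andP[nu_anti _].
by rewrite IHn.
Qed.

End Chains.

(** * Reverse plane partitions as chains of partitions *)

Section Fillings.
(** Boxes form an abstract type with coordinate maps, so that columns can be indexed by ['I_l]; [mu]
    and [la] bound the columns of the shape. *)
Variables (A : comNzRingType) (t : nat -> A) (B : finType) (p l N n : nat).
Variables (x : 'I_n -> A) (row : B -> 'I_p) (col : B -> 'I_l).
Variables mu la : {ffun 'I_l -> 'I_N.+1}.
Hypotheses (mu_anti : antitone mu) (la_anti : antitone la) (mu_la : part_le mu la).
Hypothesis la_p : forall c, (la c <= p)%N.
Hypothesis box_bounds : forall b, (mu (col b) <= row b < la (col b))%N.
Hypothesis box_inj : forall b b', row b = row b' -> col b = col b' -> b = b'.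
Hypothesis box_ex : forall (r : nat) c, (mu c <= r < la c)%N ->
  exists2 b, nat_of_ord (row b) = r & col b = c.

Implicit Types (T : {ffun B -> 'I_n}) (h : {ffun 'I_n.+1 -> {ffun 'I_l -> 'I_N.+1}}).

Let rpp T := [forall b1, forall b2,
  ((row b1 == row b2) && (col b1 <= col b2)%N
    || (col b1 == col b2) && (row b1 <= row b2)%N) ==> (T b1 <= T b2)%N].

Let below_eq T b := [exists b', [&& col b' == col b,
  nat_of_ord (row b') == (row b).+1 & T b' == T b]].

Let filling_weight T :=
  (\prod_(r < p) t r.+1 ^+ #|[set b | (row b == r) && below_eq T b]|) *
  \prod_(i < n) x i ^+ #|[set c | [exists b, (col b == c) && (T b == i)]]|.

(* [h] records the level sets of [T]: in column [c] the boxes of the outer shape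
   that are in the inner shape or carry an entry smaller than [v] are the top [h v c]. *)
Definition level_sets T h := forall b (v : nat), (v <= n)%N ->
  (T b < v)%N = (row b < h (inord v) (col b))%N.

Let chain h := is_chain mu la h.

Let rppP T : reflect
  ((forall b1 b2, row b1 = row b2 -> (col b1 <= col b2)%N -> (T b1 <= T b2)%N) /\
   (forall b1 b2, col b1 = col b2 -> (row b1 <= row b2)%N -> (T b1 <= T b2)%N))
  (rpp T).
Proof.
apply: (iffP forallP) => [TP|[Trow Tcol] b1].
  split=> b1 b2 e le; apply: (implyP (forallP (TP b1) b2)).
    by rewrite e eqxx le.
  by rewrite e eqxx le orbT.
apply/forallP => b2; apply/implyP => /orP[] /andP[/eqP e le].
  exact: Trow.
exact: Tcol.
Qed.

Let chain_mono h : chain h -> forall v w c, (v <= w <= n)%N ->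
  (h (inord v) c <= h (inord w) c)%N.
Proof.
case/and3P=> _ _ /forallP hP v w c; elim: w => [|w IHw] /andP[vw wn].
  by move: vw; rewrite leqn0 => /eqP ->.
move: vw; rewrite leq_eqVlt => /orP[/eqP -> //|vw].
apply: leq_trans (IHw _) _; first by apply/andP; split; lia.
by have /andP[_ /forallP] := hP (Ordinal wn); apply.
Qed.

Let chain_first h : chain h -> h (inord 0) = mu.
Proof.
by case/and3P=> /eqP <- _ _; congr (h _); apply: val_inj; rewrite /= inordK.
Qed.

Let chain_last h : chain h -> h (inord n) = la.
Proof.
by case/and3P=> _ /eqP <- _; congr (h _); apply: val_inj; rewrite /= inordK.
Qed.

Let chain_ge h : chain h -> forall v c, (v <= n)%N -> (mu c <= h (inord v) c)%N.
Proof. by move=> hch v c vn; rewrite -(chain_first hch) chain_mono. Qed.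

Let chain_le h : chain h -> forall v c, (v <= n)%N -> (h (inord v) c <= la c)%N.
Proof.
by move=> hch v c vn; rewrite -[in leqRHS](chain_last hch) chain_mono // vn leqnn.
Qed.

Let chain_anti h : chain h -> forall v, (v <= n)%N -> antitone (h (inord v)).
Proof.
move=> hch v; rewrite leq_eqVlt => /orP[/eqP ->|vn]; first by rewrite chain_last.
by have /and3P[_ _ /forallP/(_ (Ordinal vn))/andP[]] := hch.
Qed.

(** If two heights differed, the box just below the smaller one would get contradictory conditions
    on its entry. *)
Let level_sets_inj T h h' : chain h -> chain h' ->
  level_sets T h -> level_sets T h' -> h = h'.
Proof.
have half h1 h2 v c : chain h1 -> chain h2 -> level_sets T h1 -> level_sets T h2 ->
    (v <= n)%N -> (h1 (inord v) c <= h2 (inord v) c)%N.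
  move=> ch1 ch2 l1 l2 vn; rewrite leqNgt; apply/negP => lt21.
  have [b rb cb] : exists2 b, nat_of_ord (row b) = h2 (inord v) c & col b = c.
    apply: box_ex; rewrite chain_ge //=; apply: leq_trans lt21 _.
    exact: chain_le.
  by move: (l1 b v vn); rewrite (l2 b v vn) cb rb lt21 ltnn.
move=> ch ch' lh lh'; apply/ffunP => v; apply/ffunP => c; apply/val_inj/eqP.
have vn : (v <= n)%N by rewrite -ltnS.
by rewrite eqn_leq -(inord_val v) !half.
Qed.

Let filling_inj T T' h : level_sets T h -> level_sets T' h -> T = T'.
Proof.
have half U U' b : level_sets U h -> level_sets U' h -> (U b <= U' b)%N.
  by move=> lU lU'; rewrite -ltnS lU // -lU' // ltnSn.
by move=> lT lT'; apply/ffunP => b; apply/val_inj/eqP; rewrite eqn_leq !half.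
Qed.

Let chain_filling h : chain h -> exists T, level_sets T h.
Proof.
move=> hch.
have exT b : exists v : 'I_n,
    (h (inord v) (col b) <= row b < h (inord v.+1) (col b))%N.
  have exv : exists v, (v <= n)%N && (row b < h (inord v) (col b))%N.
    by exists n; rewrite leqnn chain_last //; case/andP: (box_bounds b).
  (* The least level containing the box is not level 0, which is [mu]; its predecessor is the
     entry. *)
  case: (ex_minnP exv) => -[|v] /andP[vn hv] vmin.
    by move: hv; rewrite chain_first // ltnNge; case/andP: (box_bounds b) => ->.
  exists (Ordinal vn); rewrite hv andbT leqNgt; apply/negP => hv'.
  by have := vmin v; rewrite hv' (ltnW vn) ltnn => /(_ isT).
exists [ffun b => xchoose (exT b)] => b v vn; rewrite ffunE.
have /andP[le lt] := xchooseP (exT b); set u := xchoose _ in le lt *.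
apply/idP/idP => [uv|hv].
  by apply: leq_trans lt _; rewrite chain_mono // uv.
rewrite ltnNge; apply: contraTN hv => vu; rewrite -leqNgt.
by apply: leq_trans le; rewrite chain_mono // vu ltnW.
Qed.

(** Rows increase because each level is a partition, columns because each level fills a column from
    the top. *)
Let level_sets_rpp T h : chain h -> level_sets T h -> rpp T.
Proof.
move=> hch lT; apply/rppP; split => b1 b2 e le; rewrite -ltnS lT // ?e.
  apply: leq_trans (antitoneP _ (chain_anti hch (ltn_ord (T b2))) _ _ le).
  by rewrite -lT.
by apply: leq_ltn_trans le _; rewrite -lT.
Qed.

(** The height of column [c] is one past its lowest box with entry below [v], or [mu c] if there is
    no such box. *)
Definition filling_chain T : {ffun 'I_n.+1 -> {ffun 'I_l -> 'I_N.+1}} :=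
  [ffun v : 'I_n.+1 => [ffun c : 'I_l => inord
    (maxn (mu c) (\max_(b | (col b == c) && (T b < v)%N) (row b).+1))]].

Let filling_chainE T v c : (v <= n)%N -> filling_chain T (inord v) c
  = maxn (mu c) (\max_(b | (col b == c) && (T b < v)%N) (row b).+1) :> nat.
Proof.
move=> vn; rewrite !ffunE inordK (inordK vn) //.
apply: leq_trans (ltn_ord (la c)); rewrite ltnS geq_max.
rewrite (forallP mu_la) /=; apply/bigmax_leqP => b /andP[/eqP <- _].
by case/andP: (box_bounds b).
Qed.

Let filling_chain_level_sets T : rpp T -> level_sets T (filling_chain T).
Proof.
move=> /rppP[_ Tcol] b v vn; rewrite filling_chainE //; apply/idP/idP => [Tv|].
  rewrite leq_max; apply/orP; right.
  by apply: (leq_bigmax_cond (F := fun b => (row b).+1)); rewrite eqxx.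
apply: contraTT; rewrite -!leqNgt => vT; rewrite geq_max.
case/andP: (box_bounds b) => -> _ /=; apply/bigmax_leqP => b' /andP[/eqP e Tv].
rewrite ltnNge; apply/negP => le.
by have := Tcol _ _ (Logic.eq_sym e) le; rewrite leqNgt (leq_trans Tv).
Qed.

Let filling_chain_chain T : rpp T -> chain (filling_chain T).
Proof.
move=> Trpp; have lT := filling_chain_level_sets Trpp; have [Trow _] := rppP _ Trpp.
have le_la v c : (v <= n)%N -> (filling_chain T (inord v) c <= la c)%N.
  move=> vn; rewrite filling_chainE // geq_max (forallP mu_la) /=.
  apply/bigmax_leqP => b /andP[/eqP <- _].
  by case/andP: (box_bounds b).
apply/and3P; split.
- apply/eqP/ffunP => c; apply: val_inj => /=.
  by rewrite -(inord_val ord0) filling_chainE // big_pred0 ?maxn0 // => b; rewrite andbF.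
- apply/eqP/ffunP => c; apply/val_inj/eqP; rewrite eqn_leq -(inord_val ord_max) /=.
  rewrite le_la //= leqNgt; apply/negP => lt.
  (* The box just below a height short of [la c] would need an entry outside ['I_n]. *)
  have ge : (mu c <= filling_chain T (inord n) c)%N.
    by rewrite filling_chainE // leq_maxl.
  have [b rb cb] : exists2 b,
      nat_of_ord (row b) = filling_chain T (inord n) c & col b = c.
    by apply: box_ex; rewrite ge lt.
  by have := lT b n (leqnn n); rewrite ltn_ord cb rb ltnn.
apply/forallP => v; have vn := ltn_ord v; have vn' := ltnW vn; apply/andP; split.
  apply/antitoneP => i j ij; rewrite [leqLHS]filling_chainE // geq_max.
  apply/andP; split.
    rewrite filling_chainE // leq_max (antitoneP _ mu_anti) //.
  apply/bigmax_leqP => b /andP[/eqP bj Tv].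
  (* In column [i], further left, the position in the same row lies in [mu] or holds an entry at
     most [T b]. *)
  case: (ltnP (row b) (mu i)) => [rb|rb].
    by rewrite filling_chainE // leq_max rb.
  have [b' rb' cb'] : exists2 b', nat_of_ord (row b') = row b & col b' = i.
    apply: box_ex; rewrite rb /=; case/andP: (box_bounds b) => _ /leq_trans; apply.
    by rewrite bj (antitoneP _ la_anti).
  rewrite -rb' -cb' -lT //; apply: leq_ltn_trans Tv.
  by apply: Trow; [apply: val_inj | rewrite cb' bj].
apply/forallP => c; rewrite !filling_chainE // geq_max leq_maxl /=.
apply/bigmax_leqP => b /andP[bc Tv]; rewrite leq_max; apply/orP; right.
by apply: (leq_bigmax_cond (F := fun b => (row b).+1)); rewrite bc ltnS ltnW.
Qed.

Let level_eq T h b (v : 'I_n) : level_sets T h ->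
  (T b == v) = (h (inord v) (col b) <= row b < h (inord v.+1) (col b))%N.
Proof.
move=> lT; rewrite leqNgt -(lT b v (ltnW (ltn_ord v))) -(lT b v.+1 (ltn_ord v)).
by rewrite -leqNgt ltnS -eqn_leq eq_sym.
Qed.

Let level_at T h b : level_sets T h ->
  (h (inord (T b)) (col b) <= row b < h (inord (T b).+1) (col b))%N.
Proof. by move=> lT; rewrite -(level_eq _ _ lT). Qed.

Let below_eqE T h b : chain h -> level_sets T h ->
  below_eq T b = ((row b).+1 < h (inord (T b).+1) (col b))%N.
Proof.
move=> hch lT; apply/existsP/idP => [[b' /and3P[/eqP cb' /eqP rb' /eqP Tb']]|lt].
  by rewrite -rb' -cb' -lT ?Tb'.
have [b' rb' cb'] : exists2 b', nat_of_ord (row b') = (row b).+1 & col b' = col b.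
  apply: box_ex; rewrite (leq_trans lt) ?chain_le // andbT ltnW // ltnS.
  by case/andP: (box_bounds b).
exists b'; rewrite cb' rb' !eqxx (level_eq _ _ lT) cb' rb' lt andbT.
by case/andP: (level_at b lT) => le _; apply: leq_trans (leqnSn _).
Qed.

(** A column contains the entry [v] exactly when its height grows at step [v], and every box added
    then, except the lowest, has an equal entry below. *)
Let level_sets_weight T h : chain h -> level_sets T h ->
  filling_weight T = chain_weight t x h.
Proof.
move=> hch lT; rewrite /filling_weight /chain_weight /step_weight mulrC.
under [RHS]eq_bigr do rewrite big_split /=.
rewrite big_split /=; congr (_ * _).
  apply: eq_bigr => v _; rewrite -prodr_const big_mkcond; apply: eq_bigr => c _ /=.
  congr (if _ then _ else _); rewrite inE; apply/existsP/idP => [[b]|lt].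
    by rewrite (level_eq _ _ lT) => /andP[/eqP <- /andP[]]; apply: leq_ltn_trans.
  have [b rb cb] : exists2 b, nat_of_ord (row b) = h (inord v) c & col b = c.
    apply: box_ex; rewrite chain_ge ?(leq_trans lt) ?chain_le //; exact: ltnW.
  by exists b; rewrite (level_eq _ _ lT) cb rb eqxx leqnn.
transitivity (\prod_(b | below_eq T b) t (row b).+1).
  rewrite [RHS](partition_big row predT) //=; apply: eq_bigr => r _.
  rewrite -prodr_const; apply: eq_big => [b|b]; first by rewrite inE andbC.
  by rewrite inE => /andP[/eqP -> _].
rewrite (partition_big T predT) //=; apply: eq_bigr => v _.
rewrite (partition_big col predT) //=; apply: eq_bigr => c _.
(* Row [r] has weight [t r.+1], so the index of [step_weight] is shifted by one. *)
rewrite (partition_big row predT) //= big_add1.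
have vn := ltn_ord v.
rewrite (big_nat_widen _ _ p); last first.
  by rewrite (leq_trans (leq_pred _)) // (leq_trans _ (la_p c)) // chain_le.
rewrite (big_nat_widenl _ 0) // big_mkord [RHS]big_mkcond; apply: eq_bigr => r _ /=.
case: ifP => [/andP[lt le]|ncond].
  have lt' : (r.+1 < h (inord v.+1) c)%N by move: lt; case: (nat_of_ord (h _ c)).
  have [b rb cb] : exists2 b, nat_of_ord (row b) = r & col b = c.
    apply: box_ex; rewrite (leq_trans _ le) ?chain_ge ?(leq_trans (ltnW lt')) //.
      exact: chain_le.
    exact: ltnW.
  have Tb : T b = v by apply/eqP; rewrite (level_eq _ _ lT) cb rb le ltnW.
  rewrite (big_pred1 b) ?rb // => b' /=.
  apply/idP/eqP => [/andP[/andP[/andP[_ _] /eqP cb'] /eqP rb']|->].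
    by apply: box_inj; rewrite ?cb' ?rb' //; apply: val_inj.
  by rewrite (below_eqE _ hch lT) Tb cb rb lt' !eqxx /=; apply/eqP/val_inj.
rewrite big_pred0 // => b; apply/negP => /andP[/andP[/andP[bel /eqP Tb] /eqP cb] /eqP rb].
move: ncond; have := level_at b lT; rewrite Tb => /andP[le _].
move: bel; rewrite (below_eqE _ hch lT) Tb -rb -cb le andbT.
by case: (nat_of_ord (h _ _)) => // k; rewrite ltnS => ->.
Qed.

(** The fibre of [filling_chain] over a chain is the single filling provided by [chain_filling]. *)
Lemma sum_rpp_chains :
  \sum_(T | rpp T) filling_weight T = \sum_(h | is_chain mu la h) chain_weight t x h.
Proof.
rewrite (partition_big filling_chain chain) => [|T]; last exact: filling_chain_chain.
apply: eq_bigr => h hch; have [T lT] := chain_filling hch.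
have Trpp := level_sets_rpp hch lT.
rewrite (big_pred1 T) => [|T' /=]; first exact: level_sets_weight.
apply/andP/eqP => [[T'rpp /eqP hT']|->].
  by apply: filling_inj lT; rewrite -hT'; apply: filling_chain_level_sets.
split=> //; apply/eqP/(@level_sets_inj T) => //; first exact: filling_chain_chain.
exact: filling_chain_level_sets.
Qed.

End Fillings.

(** * Conjugate partitions and the concrete skew shape *)

Section ConjugateShapes.
Implicit Types s : seq nat.

Lemma part_le_head s c : is_partition s -> (nth 0 s c <= head 0 s)%N.
Proof.
rewrite /is_partition; case: s => [|a s]; first by rewrite nth_nil.
move=> /= /(order_path_min (fun b a c ba cb => leq_trans cb ba)) /allP sa.
case: c => //= c; case: (ltnP c (size s)) => [cs|cs]; last by rewrite nth_default.
exact/sa/mem_nth.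
Qed.

(** The parts exceeding [r] form an initial segment of a weakly decreasing sequence. *)
Lemma ltn_count_part s r c : is_partition s ->
  (c < count (ltn r) s)%N = (r < nth 0 s c)%N.
Proof.
elim: s c => [|a s IHs] c sP; first by rewrite nth_nil.
have /IHs {}IHs : is_partition s by move: sP; apply: path_sorted.
have := fun c => part_le_head c sP; move: IHs => /= IHs le.
case: (ltnP r a) => [ra|ar]; first by case: c => [|c]; rewrite ?ra // -IHs.
have -> : count (ltn r) s = 0%N.
  by apply/eqP; rewrite -leqn0 leqNgt IHs -leqNgt (leq_trans (le 1%N)).
by rewrite ltn0 ltnNge (leq_trans (le c)).
Qed.

Lemma ltn_nth_conj_part s r c : is_partition s ->
  (c < nth 0 (conj_part s) r)%N = (r < nth 0 s c)%N.
Proof.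
move=> sP; rewrite -(ltn_count_part r c sP); case: (ltnP r (head 0%N s)) => [rs|sr].
  by rewrite nth_mkseq.
rewrite nth_default ?size_mkseq // ltn_count_part // ltn0.
by apply/Logic.eq_sym/negbTE; rewrite -leqNgt (leq_trans (part_le_head c sP)).
Qed.

(** The first conjugate part counts the positive parts; this identifies the columns of the shape
    with ['I_l]. *)
Lemma head_conj_part l (la : l.-tuple nat) :
  (forall i, 0 < tnth la i)%N -> head 0%N (conj_part la) = l.
Proof.
case: l la => [la _|l la la_pos]; first by rewrite tuple0.
have : (0 < head 0 la)%N.
  by have := la_pos ord0; rewrite (tnth_nth 0%N); case: (tval la).
rewrite /conj_part; case: (head 0 la)%N => //= N _.
rewrite -[RHS](size_tuple la); apply/eqP; rewrite -all_count.
by apply/all_tnthP => i; apply: la_pos.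
Qed.

End ConjugateShapes.

Section TupleShapes.
Variables (l N : nat).
Implicit Types s : l.-tuple nat.

(** Bounding the parts by [N] makes the partitions, and hence the chains, a finite type. *)
Definition part_ffun s : {ffun 'I_l -> 'I_N.+1} := [ffun i => inord (tnth s i)].

Lemma part_ffunE s : (forall i, tnth s i <= N)%N ->
  forall i, part_ffun s i = nth 0%N s i :> nat.
Proof. by move=> sN i; rewrite ffunE inordK ?ltnS // (tnth_nth 0%N). Qed.

Lemma part_ffun_antitone s : is_partition s -> (forall i, tnth s i <= N)%N ->
  antitone (part_ffun s).
Proof.
move=> sP sN; apply/antitoneP => i j ij; rewrite !part_ffunE //.
apply: (sorted_leq_nth (fun b a c ba cb => leq_trans cb ba) leqnn 0%N sP) => //;
  by rewrite inE size_tuple.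
Qed.

End TupleShapes.

Lemma dual_groth_chains (A : comNzRingType) (t : nat -> A) n (x : 'I_n -> A)
    l N (la mu : l.-tuple nat) :
    is_partition la -> is_partition mu ->
    (forall i, 0 < tnth la i)%N -> (forall i, tnth mu i <= tnth la i)%N ->
    (forall i, tnth la i <= N)%N ->
  dual_groth (conj_part la) (conj_part mu) x t
  = \sum_(h | is_chain (part_ffun N mu) (part_ffun N la) h) chain_weight t x h.
Proof.
move=> laP muP la_pos mu_la laN.
have muN i : (tnth mu i <= N)%N by apply: leq_trans (laN i).
have e := head_conj_part la_pos.
pose row := @brow (conj_part la) (conj_part mu).
pose col b := cast_ord e (@bcol (conj_part la) (conj_part mu) b).
rewrite -(@sum_rpp_chains A t _ _ l N n x row col); first 1 last.
- exact: part_ffun_antitone.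
- exact: part_ffun_antitone.
- by apply/forallP => i; rewrite !part_ffunE // -!tnth_nth.
- by move=> c; rewrite part_ffunE // size_mkseq part_le_head.
- move=> b; rewrite !part_ffunE //=; have := valP b; rewrite /in_skew /=.
  by rewrite leqNgt !ltn_nth_conj_part // -leqNgt.
- move=> b b' rb /cast_ord_inj cb; apply: val_inj.
  by rewrite [val b]surjective_pairing [val b']surjective_pairing; congr (_, _).
- move=> r c; rewrite !part_ffunE // => rc.
  have rL : (r < size (conj_part la))%N.
    by case/andP: rc => _ /leq_trans; apply; rewrite size_mkseq part_le_head.
  have skew : in_skew (conj_part mu) (Ordinal rL, cast_ord (Logic.eq_sym e) c).
    by rewrite /in_skew /= leqNgt !ltn_nth_conj_part // -leqNgt.
  by exists (exist (@in_skew _ _) _ skew); last exact: val_inj.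
apply: eq_big => [T|T _].
  apply: eq_forallb => b1; apply: eq_forallb => b2.
  by rewrite (inj_eq (@cast_ord_inj _ _ e)).
congr (_ * _); apply: eq_bigr => i _; congr (_ ^+ _).
(* The set of columns containing the entry is carried over to ['I_l] by the cast. *)
rewrite /rpp_a -(card_imset _ (@cast_ord_inj _ _ e)); apply: eq_card => c.
rewrite -[c in LHS](cast_ordKV e) mem_imset ?inE; last exact: cast_ord_inj.
by apply: eq_existsb => b; congr (_ && _).
Qed.

Theorem theorem4p19 (R : comNzRingType) (n l : nat) (la mu : l.-tuple nat)
    (la_part : is_partition la) (la_pos : forall i : 'I_l, (0 < tnth la i)%N)
    (mu_part : is_partition mu)
    (mu_la : forall i : 'I_l, (tnth mu i <= tnth la i)%N) :
  let x : 'I_n -> {mpoly R[n + head 0%N la]} := xvar R (head 0%N la) in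
  let t : nat -> {mpoly R[n + head 0%N la]} := tvar R n (head 0%N la) in
  dual_groth (conj_part la) (conj_part mu) x t
  = \det (\matrix_(i < l, j < l)
      alpha_sum (codom x) t (tnth la i) (tnth mu j)
        ((tnth la i)%:Z - (tnth mu j)%:Z - i%:Z + j%:Z)).
Proof.
move=> x t; have laN i : (tnth la i <= head 0 la)%N.
  by rewrite (tnth_nth 0%N) part_le_head.
have muN i : (tnth mu i <= head 0 la)%N by apply: leq_trans (laN i).
rewrite (dual_groth_chains t x la_part mu_part la_pos mu_la laN).
rewrite -det_jt_mx_chains; [|exact: part_ffun_antitone..].
congr (\det _); apply/matrixP => i j.
by rewrite !mxE /jt_entry !part_ffunE // -!tnth_nth.
Qed.
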